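(* Let $N\ge3$ be an odd integer, let $\Sigma_{0,3}$ be the pair of pants, and let $S=\chi(\Sigma_{0,3})-\{0\}$. As an algebra over the field of fractions $S^{-1}\chi(\Sigma_{0,3})$ of $\chi(\Sigma_{0,3})$, $S^{-1}K_N(\Sigma_{0,3})$, equipped with the normalized trace $Tr$, is Frobenius.
   Context: Let $A=e^{\pi i/N}$. The Tchebychev polynomials are $T_0(x)=2$, $T_1(x)=x$, $T_{n+1}(x)=xT_n(x)-T_{n-1}(x)$. $\Sigma_{0,3}$ is the compact oriented planar surface with three boundary components. Its Kauffman bracket skein algebra $K_N(\Sigma_{0,3})$ (framed links in $\Sigma_{0,3}\times[0,1]$ modulo the Kauffman bracket skein relations with parameter $A$, with stacking product) is isomorphic to $\mathbb{C}[x,y,z]$, where $x,y,z$ are blackboard framed curves parallel to the three boundary components. The subalgebra $\chi(\Sigma_{0,3})$ is the image of the threading map (threading every component of a framed link with $T_N$); it is the span of $\{T_{Na}(x)T_{Nb}(y)T_{Nc}(z): a,b,c\ge0\}$. $S^{-1}\chi(\Sigma_{0,3})$ is the field of fractions of $\chi(\Sigma_{0,3})$ and $S^{-1}K_N(\Sigma_{0,3})$ the localization. The normalized trace $Tr:S^{-1}K_N(\Sigma_{0,3})\to S^{-1}\chi(\Sigma_{0,3})$ is $\frac1{N^3}$ times the trace of left multiplication ($N^3$ being the dimension of $S^{-1}K_N(\Sigma_{0,3})$ over $S^{-1}\chi(\Sigma_{0,3})$). A Frobenius algebra over a field $k$ is a finite dimensional $k$-algebra $B$ equipped with a $k$-linear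 functional $\epsilon:B\to k$ having no nontrivial principal ideals in its kernel; equivalently, for every $a\ne0$ in $B$ there is $b\in B$ with $\epsilon(ab)\neq0$. *)

(* Defs.v *)
From HB Require Import structures.
From mathcomp Require Import all_boot all_order all_algebra ring.
From mathcomp Require Import boolp classical_sets reals complex mpoly.

Set Implicit Arguments.
Unset Strict Implicit.
Unset Printing Implicit Defensive.

Import GRing.Theory Num.Theory.
Local Open Scope ring_scope.
Local Open Scope quotient_scope.

Local Notation "x %:F" := (@FracField.tofrac _ x).

(* The field of fractions is functorial for injective ring morphisms.         *)
Section FracMap.
Variables (D E : idomainType) (f : {rmorphism D -> E}).
Hypothesis f_inj : injective f.

Definition frac_map (_ : injective f) (c : {fraction D}) : {fraction E} :=
  (f (\n_(repr c)))%:F / (f (\d_(repr c)))%:F.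

Local Notation fm := (frac_map f_inj).

Lemma frac_reprE (c : {fraction D}) :
  c = (\n_(repr c))%:F / (\d_(repr c))%:F.
Proof.
have d0 : (\d_(repr c))%:F != 0 :> {fraction D}.
  by rewrite tofrac_eq0 denom_ratioP.
apply: (mulIf d0); rewrite divfK //.
rewrite -{1}[c]reprK; unlock FracField.tofrac.
rewrite !piE; apply/eqmodP => /=.
rewrite FracField.equivfE !numden_Ratio ?oner_eq0 ?mulr1 ?denom_ratioP //.
by rewrite mulrC.
Qed.

Lemma fmap_neq0 (b : D) : b != 0 -> (f b)%:F != 0 :> {fraction E}.
Proof. by rewrite tofrac_eq0 -(rmorph0 f) (inj_eq f_inj). Qed.

Lemma frac_mapE (a b : D) : b != 0 ->
  fm (a%:F / b%:F) = (f a)%:F / (f b)%:F.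
Proof.
move=> b0; set c := _ / _; rewrite /frac_map.
have d0 := denom_ratioP (repr c).
apply/eqP; rewrite eqr_div ?fmap_neq0 // -!tofracM tofrac_eq -!rmorphM.
rewrite (inj_eq f_inj) -tofrac_eq !tofracM -eqr_div ?tofrac_eq0 //.
by rewrite -frac_reprE.
Qed.

Lemma frac_map_zmod : zmod_morphism fm.
Proof.
move=> c d; rewrite [in LHS](frac_reprE c) [in LHS](frac_reprE d).
have c0 := denom_ratioP (repr c); have d0 := denom_ratioP (repr d).
have e0 : \d_(repr c) * \d_(repr d) != 0 by rewrite mulf_neq0.
rewrite -mulNr addf_div ?tofrac_eq0 // -tofracN -!tofracM -tofracD.
rewrite frac_mapE // /frac_map -mulNr addf_div ?fmap_neq0 //.
by rewrite rmorphD !rmorphM rmorphN !(tofracD, tofracM, tofracN).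
Qed.

Lemma frac_map_monoid : monoid_morphism fm.
Proof.
split.
  rewrite -[1 in LHS](divr1 1) -tofrac1 frac_mapE ?oner_eq0 //.
  by rewrite rmorph1 tofrac1 divr1.
move=> c d; rewrite [in LHS](frac_reprE c) [in LHS](frac_reprE d).
have c0 := denom_ratioP (repr c); have d0 := denom_ratioP (repr d).
have e0 : \d_(repr c) * \d_(repr d) != 0 by rewrite mulf_neq0.
rewrite mulf_div -!tofracM frac_mapE // /frac_map mulf_div.
by rewrite !rmorphM.
Qed.

HB.instance Definition _ :=
  GRing.isZmodMorphism.Build {fraction D} {fraction E} fm frac_map_zmod.
HB.instance Definition _ :=
  GRing.isMonoidMorphism.Build {fraction D} {fraction E} fm frac_map_monoid.

End FracMap.

Section LinearAlgebra.
Variable k : fieldType.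

Definition finite_dimensional (V : lmodType k) : Prop :=
  exists n, inhabited (Vector.axiom n V).

(* phi is the coordinate isomorphism of a basis; since mathcomp matrices act  *)
(* on row vectors, lin1_mx is the transpose of the usual matrix.              *)
Definition is_trace (V : lmodType k) (f : V -> V) (t : k) : Prop :=
  exists n (phi : V -> 'rV[k]_n) (psi : 'rV[k]_n -> V),
    [/\ linear phi, cancel phi psi, cancel psi phi
      & t = \tr (lin1_mx (phi \o f \o psi))].

Lemma is_trace_uniq (V : lmodType k) (f : V -> V) (t t' : k) :
  linear f -> is_trace f t -> is_trace f t' -> t = t'.
Proof.
move=> fl [n [p [q [pl pq qp ->]]]] [m [p' [q' [pl' pq' qp' ->]]]].
have ql : linear q by move=> a u v; apply: (can_inj pq); rewrite pl !qp.
have ql' : linear q' by move=> a u v; apply: (can_inj pq'); rewrite pl' !qp'.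
have lin1E r s (g : 'rV[k]_r -> 'rV[k]_s) : linear g -> forall u, u *m lin1_mx g = g u.
  move=> gl u; pose gm := GRing.isLinear.Build k _ _ _ g gl.
  pose gL : {linear _ -> _} := HB.pack g gm.
  exact: (mul_rV_lin1 gL).
pose P := lin1_mx (p \o q'); pose Q := lin1_mx (p' \o q).
have l1 : linear (p \o q') by move=> a u v /=; rewrite ql' pl.
have l2 : linear (p' \o q) by move=> a u v /=; rewrite ql pl'.
have l3 : linear (p \o f \o q) by move=> a u v /=; rewrite ql fl pl.
have l4 : linear (p' \o f \o q') by move=> a u v /=; rewrite ql' fl pl'.
have -> : lin1_mx (p \o f \o q) = Q *m lin1_mx (p' \o f \o q') *m P.
  by apply/row_matrixP => i; rewrite !rowE !mulmxA !lin1E //= !pq'.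
rewrite -mulmxA mxtrace_mulC -mulmxA (_ : P *m Q = 1%:M) ?mulmx1 //.
by apply/row_matrixP => i; rewrite !rowE mulmxA mulmx1 !lin1E //= pq qp'.
Qed.

(* 0 if V is not finite dimensional.                                          *)
Definition trace (V : lmodType k) (f : V -> V) : k :=
  xget 0 [set t | is_trace f t]%classic.

Definition frobenius (B : algType k) (eps : B -> k) : Prop :=
  [/\ finite_dimensional B, scalar eps
    & forall a : B, a != 0 -> exists b : B, eps (a * b) != 0].

End LinearAlgebra.

(* Tchebychev polynomials, normalized by T_0 = 2.                             *)
Fixpoint tcheb (A : comNzRingType) (n : nat) (x : A) : A :=
  match n with
  | 0 => 2%:R
  | 1 => x
  | (m.+1 as n').+1 => x * tcheb n' x - tcheb m x
  end.

Lemma tchebSS (A : comNzRingType) n (x : A) :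
  tcheb n.+2 x = x * tcheb n.+1 x - tcheb n x.
Proof. by []. Qed.

Lemma tcheb_morph (A B : comNzRingType) (h : {rmorphism A -> B}) n x :
  h (tcheb n x) = tcheb n (h x).
Proof.
suff: h (tcheb n x) = tcheb n (h x) /\ h (tcheb n.+1 x) = tcheb n.+1 (h x) by case.
elim: n => [|n [IH1 IH2]]; first by rewrite /= rmorph_nat.
by split=> //; rewrite !tchebSS rmorphB rmorphM IH1 IH2.
Qed.

Lemma tcheb_add (A : comNzRingType) m n (x : A) :
  tcheb (m + n + n) x = tcheb n x * tcheb (m + n) x - tcheb m x.
Proof.
suff: forall m, tcheb (m + n + n) x = tcheb n x * tcheb (m + n) x - tcheb m x
  /\ tcheb (m + n.+1 + n.+1) x = tcheb n.+1 x * tcheb (m + n.+1) x - tcheb m x.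
  by move/(_ m) => [].
elim: n => {m} [m|n IH m].
  by rewrite !addn0 !addn1 /=; split; ring.
split; first by have [] := IH m.
have [E1 _] := IH m.+2; have [_ E2] := IH m.+1.
have e1 : (m + n.+2 + n.+2 = (m.+1 + n.+1 + n.+1).+1)%N by ring.
rewrite e1; have e2 : (m.+1 + n.+1 + n.+1 = (m.+2 + n + n).+1)%N by ring.
rewrite e2 tchebSS -e2 E1 E2.
have -> : (m.+1 + n.+1 = m + n.+2)%N by ring.
have -> : (m.+2 + n = m + n.+2)%N by ring.
rewrite !tchebSS; ring.
Qed.

Lemma tchebM (A : comNzRingType) m n (x : A) :
  tcheb (m * n) x = tcheb n (tcheb m x).
Proof.
suff: tcheb (m * n) x = tcheb n (tcheb m x) /\
      tcheb (m * n.+1) x = tcheb n.+1 (tcheb m x) by case.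
elim: n => [|n [IH1 IH2]]; first by rewrite muln0 muln1.
split=> //; rewrite tchebSS -IH1 -IH2 mulnSr mulnSr -addnA addnA.
exact: tcheb_add.
Qed.

Section PairOfPants.
Variables (R : realType) (N : nat).

(* The skein algebra K_N of the pair of pants, under its standard             *)
(* identification with C[x, y, z]: the monomial x^a y^b z^c is the multicurve *)
(* made of a, b and c parallel copies of the three boundary curves, and these *)
(* multicurves form a basis. Through this identification the algebra does not *)
(* depend on the parameter A = exp(i pi / N).                                 *)
Definition skein := {mpoly R[i][3]}.
HB.instance Definition _ := GRing.IntegralDomain.on skein.
HB.instance Definition _ := GRing.Algebra.on skein.

(* The threading map: the linear map that replaces each component of a        *)
(* multicurve by its T_N, i.e. x^a y^b z^c |-> T_N(x)^a T_N(y)^b T_N(z)^c.    *)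
Definition thread (p : skein) : skein :=
  p \mPo [tuple tcheb N ('X_i : skein) | i < 3].

Definition chi : {pred skein} := fun p => `[< exists q, p = thread q >].

Lemma thread_zmod : zmod_morphism thread.
Proof. exact: comp_mpolyB. Qed.

Lemma thread_monoid : monoid_morphism thread.
Proof. by split; [exact: comp_mpoly1 | exact: rmorphM]. Qed.

HB.instance Definition _ :=
  GRing.isZmodMorphism.Build skein skein thread thread_zmod.
HB.instance Definition _ :=
  GRing.isMonoidMorphism.Build skein skein thread thread_monoid.

Section Span.
Local Notation K := skein.

Let b (m : 'X_{1..3}) : K := \prod_(i < 3) tcheb (m i) ('X_i : K).
Let sp (p : K) := exists s : seq (R[i] * 'X_{1..3}), p = \sum_(t <- s) t.1 *: b t.2.

Let spD p q : sp p -> sp q -> sp (p + q).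
Proof. by move=> [s ->] [t ->]; exists (s ++ t); rewrite big_cat. Qed.

Let spZ c p : sp p -> sp (c *: p).
Proof.
move=> [s ->]; exists [seq (c * t.1, t.2) | t <- s].
by rewrite big_map scaler_sumr; apply: eq_bigr => t _; rewrite scalerA.
Qed.

Let spb m : sp (b m).
Proof. by exists [:: (1, m)]; rewrite big_seq1 scale1r. Qed.

Let bX m (i : 'I_3) : b (m + U_(i)) = tcheb (m i).+1 'X_i * \prod_(j < 3 | j != i) tcheb (m j) ('X_j : K).
Proof.
rewrite /b (bigD1 i) //= mnmDE mnm1E eqxx addn1; congr (_ * _).
by apply: eq_bigr => j ji; rewrite mnmDE mnm1E eq_sym (negPf ji) addn0.
Qed.

Let bXm m (i : 'I_3) : sp (b m * 'X_i).
Proof.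
have E : b m = tcheb (m i) 'X_i * \prod_(j < 3 | j != i) tcheb (m j) ('X_j : K).
  by rewrite /b (bigD1 i).
case mi : (m i) => [|n].
  have -> : b m * 'X_i = 2%:R *: b (m + U_(i)).
    by rewrite E bX mi /= scaler_nat -mulr_natl; ring.
  exact: spZ.
pose m' := (m - U_(i))%MM.
have em : m = (m' + U_(i))%MM by rewrite submK // lep1mP mi.
have mi' : m' i = n by rewrite mnmBE mnm1E eqxx mi subn1.
have -> : b m * 'X_i = b (m + U_(i)) + (b m').
  rewrite bX mi {1}em bX mi' tchebSS.
  rewrite [b m'](bigD1 i) //= mi'.
  rewrite (eq_bigr (fun j => tcheb (m j) ('X_j : K))).
    ring.
  by move=> j ji; rewrite em mnmDE mnm1E eq_sym (negPf ji) addn0.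
exact: spD.
Qed.

Let spX p i : sp p -> sp (p * 'X_i).
Proof.
move=> [s ->]; elim: s => [|t s IH]; first by rewrite big_nil mul0r; exists [::]; rewrite big_nil.
rewrite big_cons mulrDl; apply: spD => //.
by rewrite -scalerAl; apply: spZ.
Qed.

Let sp1 : sp 1.
Proof.
have -> : 1 = 8%:R^-1 *: b 0%MM :> K.
  have -> : b 0%MM = 8%:R *: 1 :> K.
    by rewrite /b !big_ord_recl big_ord0 !mnm0E /= scaler_nat; ring.
  by rewrite scalerA mulVf ?scale1r // pnatr_eq0.
exact/spZ/spb.
Qed.

Lemma tcheb_span (p : K) : sp p.
Proof.
elim/mpolyind: p => [|c m p _ _ IH]; first by exists [::]; rewrite big_nil.
apply: spD => //; apply: spZ; suff gen q : sp q -> sp (q * 'X_[m]) by rewrite -[X in sp X]mul1r; exact: gen.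
rewrite mpolyXE_id -big_enum /=; elim: (enum _) q => [|i e IHe] q spq.
  by rewrite big_nil mulr1.
rewrite big_cons mulrA; apply: IHe; elim: (m i) => [|n IHn].
  by rewrite expr0 mulr1.
by rewrite exprSr mulrA; apply: spX.
Qed.

End Span.

(* chi is the span of the T_{Na}(x) T_{Nb}(y) T_{Nc}(z).                     *)
Lemma chi_span (p : skein) :
  p \in chi <-> exists s : seq (R[i] * 'X_{1..3}),
    p = \sum_(t <- s) t.1 *: \prod_(i < 3) tcheb (N * t.2 i) ('X_i : skein).
Proof.
have thb (m : 'X_{1..3}) : thread (\prod_(i < 3) tcheb (m i) ('X_i : skein))
    = \prod_(i < 3) tcheb (N * m i) ('X_i : skein).
  rewrite rmorph_prod; apply: eq_bigr => i _; rewrite tchebM.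
  rewrite [LHS](@tcheb_morph _ _ (thread : {rmorphism _ -> skein})).
  by congr (tcheb _ _); rewrite [LHS]comp_mpolyXU -tnth_nth tnth_mktuple.
have ths (s : seq (R[i] * 'X_{1..3})) :
    thread (\sum_(t <- s) t.1 *: \prod_(i < 3) tcheb (t.2 i) ('X_i : skein))
    = \sum_(t <- s) t.1 *: \prod_(i < 3) tcheb (N * t.2 i) ('X_i : skein).
  rewrite rmorph_sum; apply: eq_bigr => t _.
  by rewrite -thb; exact: comp_mpolyZ.
split=> [/asboolP[q ->]|[s ->]].
  by have [s ->] := tcheb_span q; exists s.
by apply/asboolP; exists (\sum_(t <- s) t.1 *: \prod_(i < 3) tcheb (t.2 i) ('X_i : skein)).
Qed.

Lemma chi_divring_closed : divring_closed chi.
Proof.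
split.
- by apply/asboolP; exists 1; rewrite rmorph1.
- by move=> _ _ /asboolP[p ->] /asboolP[q ->]; apply/asboolP; exists (p - q);
     rewrite rmorphB.
- move=> _ _ /asboolP[p ->] /asboolP[q ->]; apply/asboolP.
  have [u|nu] := boolP (thread q \is a GRing.unit); last first.
    by exists (p * q); rewrite rmorphM invr_out.
  have /andP[/eqP eq u0] : thread q \in mpoly_unit (R := R[i]) (n := 3) by [].
  exists (p * ((thread q)@_0)^-1%:MP); rewrite rmorphM; congr (_ * _).
  rewrite [RHS]comp_mpolyC; apply: (mulIr u); rewrite mulVr //.
  by rewrite {2}eq -mpolyCM mulVr.
Qed.

HB.instance Definition _ :=
  GRing.isDivringClosed.Build skein chi chi_divring_closed.

(* The subalgebra chi as a ring of its own; {fraction chi_ring} is S^-1 chi.  *)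
Definition chi_ring := {p : skein | p \in chi}.
HB.instance Definition _ := SubType.on chi_ring.
HB.instance Definition _ := [Choice of chi_ring by <:].
HB.instance Definition _ := [SubChoice_isSubComUnitRing of chi_ring by <:].
HB.instance Definition _ :=
  [SubComUnitRing_isSubIntegralDomain of chi_ring by <:].

Lemma val_chi_inj : injective (\val : chi_ring -> skein).
Proof. exact: val_inj. Qed.

(* The localization S^-1 K_N, realized as the set of all p / s with p in K_N  *)
(* and s in S = chi - {0}, inside the field of fractions of the domain K_N.   *)
Definition loc_pred : {pred {fraction skein}} := fun u =>
  `[< exists p s : skein, [/\ s \in chi, s != 0 & u = p%:F / s%:F] >].

Lemma loc_subring_closed : subring_closed loc_pred.
Proof.
split.
- apply/asboolP; exists 1, 1; split; rewrite ?rpred1 ?oner_eq0 //.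
  by rewrite tofrac1 divr1.
- move=> _ _ /asboolP[p [s [sc s0 ->]]] /asboolP[q [t [tc t0 ->]]].
  apply/asboolP; exists (p * t - q * s), (s * t).
  split; rewrite ?rpredM ?mulf_neq0 //.
  by rewrite -mulNr addf_div ?tofrac_eq0 // !(tofracD, tofracN, tofracM) mulNr.
- move=> _ _ /asboolP[p [s [sc s0 ->]]] /asboolP[q [t [tc t0 ->]]].
  apply/asboolP; exists (p * q), (s * t).
  split; rewrite ?rpredM ?mulf_neq0 //.
  by rewrite mulf_div !tofracM.
Qed.

HB.instance Definition _ :=
  GRing.isSubringClosed.Build {fraction skein} loc_pred loc_subring_closed.

Definition loc_skein := {u : {fraction skein} | u \in loc_pred}.
HB.instance Definition _ := SubType.on loc_skein.
HB.instance Definition _ := [Choice of loc_skein by <:].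
HB.instance Definition _ := [SubChoice_isSubComNzRing of loc_skein by <:].

Local Notation chi_frac := {fraction chi_ring}.

Definition chi_frac_incl : {rmorphism chi_frac -> {fraction skein}} :=
  frac_map val_chi_inj.

Lemma chi_frac_incl_loc (c : chi_frac) : chi_frac_incl c \in loc_pred.
Proof.
apply/asboolP; exists (\val \n_(repr c)), (\val \d_(repr c)).
split=> //; first exact: valP.
by rewrite -(rmorph0 (\val : chi_ring -> skein)) (inj_eq val_inj) denom_ratioP.
Qed.

Definition loc_of_chi_frac (c : chi_frac) : loc_skein :=
  Sub (chi_frac_incl c) (chi_frac_incl_loc c).

(* S^-1 K_N as an algebra over the field S^-1 chi.                            *)
Definition loc_scale (c : chi_frac) (u : loc_skein) : loc_skein :=
  loc_of_chi_frac c * u.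

Lemma loc_scaleA c d u : loc_scale c (loc_scale d u) = loc_scale (c * d) u.
Proof. by apply: val_inj; rewrite !rmorphM /= mulrA rmorphM. Qed.

Lemma loc_scale1 : left_id 1 loc_scale.
Proof. by move=> u; apply: val_inj; rewrite rmorphM /= rmorph1 mul1r. Qed.

Lemma loc_scaleDr : right_distributive loc_scale +%R.
Proof. by move=> c u v; rewrite /loc_scale mulrDr. Qed.

Lemma loc_scaleDl u : {morph loc_scale^~ u : c d / c + d}.
Proof. by move=> c d; apply: val_inj; rewrite rmorphD !rmorphM /= rmorphD mulrDl. Qed.

HB.instance Definition _ := GRing.Zmodule_isLmodule.Build chi_frac loc_skein
  loc_scaleA loc_scale1 loc_scaleDr loc_scaleDl.

Lemma loc_scaleAl c (u v : loc_skein) : c *: (u * v) = (c *: u) * v.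
Proof. by rewrite /GRing.scale /= /loc_scale mulrA. Qed.

HB.instance Definition _ :=
  GRing.Lmodule_isLalgebra.Build chi_frac loc_skein loc_scaleAl.

Lemma loc_scaleAr c (u v : loc_skein) : c *: (u * v) = u * (c *: v).
Proof. by rewrite /GRing.scale /= /loc_scale mulrCA. Qed.

HB.instance Definition _ :=
  GRing.Lalgebra_isAlgebra.Build chi_frac loc_skein loc_scaleAr.

(* The normalized trace: N^-3 times the trace of left multiplication.         *)
Definition Tr (u : loc_skein) : chi_frac :=
  ((N ^ 3)%:R)^-1 * trace (fun v : loc_skein => u * v).

End PairOfPants.

(* Main.v *)
(* Since x^N = T_N(x) + (lower powers of x), and likewise for y and z, the
   monomials with all exponents < N span K_N over chi, and S^-1 K_N is a finite
   dimensional algebra over the field S^-1 chi. Being moreover a domain, it is a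
   field; for a <> 0 take b = a^-1, so that Tr (a b) = Tr 1 is a nonzero multiple
   of the dimension, which does not vanish in characteristic 0. The value N^3 of
   the dimension plays no role. *)
Require Import Defs.
From HB Require Import structures.
From mathcomp Require Import all_boot all_order all_algebra reals.
From mathcomp Require Import boolp classical_sets complex mpoly.

Set Implicit Arguments.
Unset Strict Implicit.
Unset Printing Implicit Defensive.

Import GRing.Theory Num.Theory.
Local Open Scope ring_scope.

Local Notation "x %:F" := (@FracField.tofrac _ x).

(** * Linear algebra: finite spanning families, traces of multiplications, inverses *)

Section LinearAlgebra.
Variable k : fieldType.

(** Induction on [n]: if [v] is free, coordinates are unique and give the isomorphism with row
    vectors; otherwise a nontrivial relation makes one vector redundant, and it is dropped. *)
Lemma finite_dimensional_span_ord (V : lmodType k) n (v : 'I_n -> V) :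
  (forall u, exists c : 'I_n -> k, u = \sum_i c i *: v i) ->
  finite_dimensional V.
Proof.
elim: n v => [|n IH] v span_v.
  exists 0%N; split; exists (fun=> 0).
    by move=> a u w; rewrite scaler0 addr0.
  exists (fun=> 0) => [u|w]; last by rewrite thinmx0.
  by have [c ->] := span_v u; rewrite big_ord0.
have [free_v|] :=
    pselect (forall c : 'I_n.+1 -> k,
      \sum_i c i *: v i = 0 -> forall i, c i = 0).
  have [co coP] := choice span_v.
  have co_uniq (c d : 'I_n.+1 -> k) :
      \sum_i c i *: v i = \sum_i d i *: v i -> forall i, c i = d i.
    move=> cd i; apply/eqP; rewrite -subr_eq0; apply/eqP.
    apply: (free_v (fun i => c i - d i)).
    rewrite (eq_bigr _ (fun i _ => scalerBl (c i) (d i) (v i))) sumrB cd.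
    by rewrite subrr.
  exists n.+1; split; exists (fun u => \row_i co u i).
    move=> a u w; apply/rowP => i; rewrite !mxE.
    apply: (co_uniq _ (fun i => a * co u i + co w i)).
    rewrite -coP {1}(coP u) {1}(coP w) scaler_sumr -big_split.
    by apply: eq_bigr => j _; rewrite scalerDl scalerA.
  exists (fun r : 'rV_n.+1 => \sum_i r 0 i *: v i) => [u|r].
    by rewrite [RHS]coP; apply: eq_bigr => i _; rewrite mxE.
  by apply/rowP => i; rewrite mxE; apply: co_uniq; rewrite -coP.
move=> /existsNP[c /not_implyP[c0 /existsNP[i /eqP ci]]].
apply: (IH (v \o lift i)) => u; have [d ->] := span_v u.
(* Coefficients obtained by solving the relation [c] for [v i] and substituting into the expansion
   [d] of [u]. *)
exists (fun j => d (lift i j) - d i / c i * c (lift i j)).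
have vi : v i = - \sum_j (c (lift i j) / c i) *: v (lift i j).
  move: c0; rewrite (bigD1_ord i) //= => /eqP; rewrite addr_eq0 => /eqP civ.
  rewrite -[LHS](scalerK ci) civ scalerN scaler_sumr; congr (- _).
  by apply: eq_bigr => j _; rewrite scalerA mulrC.
rewrite (bigD1_ord i) //= vi scalerN scaler_sumr addrC -sumrB.
apply: eq_bigr => j _; rewrite scalerA -scalerBl.
by congr ((_ - _) *: _); rewrite mulrA mulrAC.
Qed.

Lemma finite_dimensional_span (V : lmodType k) (I : finType) (v : I -> V) :
  (forall u, exists c : I -> k, u = \sum_i c i *: v i) ->
  finite_dimensional V.
Proof.
move=> span_v; apply: (finite_dimensional_span_ord (v := v \o enum_val)) => u.
have [c ->] := span_v u; exists (c \o enum_val).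
by rewrite (big_enum_val (A := I)).
Qed.

Lemma traceE (V : lmodType k) (f : V -> V) t :
  linear f -> is_trace f t -> trace f = t.
Proof.
move=> fl ft; apply: xget_unique => // t' ft'.
exact: (is_trace_uniq fl ft' ft).
Qed.

Lemma mul_rV_lin1_linear n m (g : 'rV[k]_n -> 'rV[k]_m) (u : 'rV[k]_n) :
  linear g -> u *m lin1_mx g = g u.
Proof.
move=> gl; pose gm := GRing.isLinear.Build k _ _ _ g gl.
pose gL : {linear _ -> _} := HB.pack g gm.
exact: (mul_rV_lin1 gL).
Qed.

Section Algebra.
Variable B : algType k.
Hypothesis B_fd : finite_dimensional B.

Lemma mul_linear (a : B) : linear (fun v => a * v).
Proof. by move=> c u v; rewrite mulrDr scalerAr. Qed.

(** One fixed basis computes the traces of all multiplications, so linearity is inherited from the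
    matrix trace. *)
Lemma trace_mul_scalar : scalar (fun a : B => trace (fun v => a * v)).
Proof.
have [n [[phi phil [psi phiK psiK]]]] := B_fd.
have tE (a : B) : trace (fun v => a * v)
    = \tr (lin1_mx (phi \o (fun v => a * v) \o psi)).
  by apply: traceE (mul_linear a) _; exists n, phi, psi; split.
move=> c a b; rewrite !tE -mxtraceZ -mxtraceD; congr (\tr _).
apply/matrixP => i j; rewrite !mxE /=.
by rewrite mulrDl -scalerAl phil !mxE.
Qed.

Lemma trace_mul1 : exists2 n, (0 < n)%N & trace (fun v : B => 1 * v) = n%:R.
Proof.
have [n [[phi phil [psi phiK psiK]]]] := B_fd.
exists n.
  rewrite lt0n; apply/eqP => n0; have := oner_neq0 B.
  (* In dimension 0 all coordinate vectors agree, which would force [1 = 0] in [B]. *)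
  rewrite -(phiK 1) -(phiK 0) (_ : phi 1 = phi 0) ?eqxx //.
  by move: (phi 1) (phi 0); rewrite n0 => r s; rewrite !thinmx0.
apply: traceE (mul_linear 1) _; exists n, phi, psi; split=> //.
rewrite -[LHS]mxtrace1; congr (\tr _); apply/row_matrixP => i.
rewrite !rowE mulmx1 mul_rV_lin1_linear /= ?mul1r ?psiK //.
by move=> c u v /=; rewrite !mul1r !psiK.
Qed.

(** An injective endomorphism of a finite dimensional space is onto, so it reaches 1. *)
Lemma right_inverse (a : B) : injective (fun v => a * v) ->
  exists b, a * b = 1.
Proof.
have [n [[phi phil [psi phiK psiK]]]] := B_fd => a_inj.
have psil : linear psi.
  by move=> c u v; apply: (can_inj phiK); rewrite phil !psiK.
pose M := lin1_mx (phi \o (fun v => a * v) \o psi).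
have ME (u : 'rV_n) : u *m M = phi (a * psi u).
  by rewrite mul_rV_lin1_linear // => c x y /=; rewrite psil mul_linear phil.
have M_unit : M \in unitmx.
  rewrite -row_free_unit; apply: inj_row_free => u; rewrite ME => u0.
  have psi0 : psi 0 = 0.
    by have := psil (-1) 0 0; rewrite scaler0 addr0 scaleN1r addNr.
  have : a * psi u = a * 0.
    by rewrite mulr0; apply: (can_inj phiK); rewrite u0 -psi0 psiK.
  by move/a_inj/(congr1 phi); rewrite psiK -psi0 psiK.
by exists (psi (phi 1 *m invmx M)); apply: (can_inj phiK); rewrite -ME mulmxKV.
Qed.

End Algebra.
End LinearAlgebra.

(** * Leading terms of Tchebychev polynomials *)

Section Chebyshev.
Variable A : comNzRingType.

(** The second bound says that the leading term is ['X^(n.+1)]; its index is shifted because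
    [T_0 = 2] is not monic. The two bounds feed each other in the induction. *)
Lemma size_tcheb n : (size (tcheb n ('X : {poly A})) <= n.+1)%N /\
  (size ('X^(n.+1) - tcheb n.+1 ('X : {poly A}))%R <= n.+1)%N.
Proof.
have szS m : (size ('X^(m.+1) - tcheb m.+1 ('X : {poly A}))%R <= m.+1)%N ->
    (size (tcheb m.+1 ('X : {poly A})) <= m.+2)%N.
  move=> sz; rewrite -[tcheb _ _](subKr 'X^(m.+1)).
  rewrite (leq_trans (size_polyD _ _)) //.
  by rewrite size_polyXn size_polyN geq_max leqnn ltnW.
elim: n => [|n [szn szd]].
  by rewrite expr1 subrr size_poly0 /= -polyC_natr size_polyC leq_b1.
split; first exact: szS.
(* X^(n+2) - T_(n+2) = X (X^(n+1) - T_(n+1)) + T_n. *)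
rewrite tchebSS exprS opprB addrCA -mulrBr addrC.
rewrite (leq_trans (size_polyD _ _)) // geq_max.
rewrite (leq_trans szn) // andbT mulrC (leq_trans (size_polyMleq _ _)) //.
by rewrite size_polyX addn2.
Qed.

Lemma expr_tcheb (B : comAlgType A) n (x : B) : (0 < n)%N ->
  exists c : nat -> A, x ^+ n = tcheb n x + \sum_(j < n) c j *: x ^+ j.
Proof.
case: n => // n _; have [_ sz] := size_tcheb n.
set d := _ - _ in sz; exists (fun j => d`_j).
have -> : \sum_(j < n.+1) d`_j *: x ^+ j = horner_alg x d.
  rewrite /horner_alg /horner_morph (@horner_coef_wide _ n.+1); last first.
    exact: leq_trans (size_poly _ _) sz.
  by apply: eq_bigr => j _; rewrite coef_map /= mulr_algl.
pose h : {rmorphism {poly A} -> B} := horner_alg x.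
have hX : h 'X = x := horner_algX x.
by rewrite -[horner_alg x d]/(h d) rmorphB rmorphXn tcheb_morph hX subrKC.
Qed.

End Chebyshev.

(** * Reduction of monomials to exponents below [N], with [h] an abstract threading map *)

Section ThreadedSpan.
Variables (F : comNzRingType) (A : comAlgType F) (n N : nat).
Variables (h : {rmorphism A -> A}) (X : 'I_n -> A).
Hypothesis N_gt0 : (0 < N)%N.
Hypothesis hA : forall c : F, h c%:A = c%:A.
Hypothesis hX : forall i, h (X i) = tcheb N (X i).

Local Notation box := {ffun 'I_n -> 'I_N}.

Definition boxmon (m : box) : A := \prod_i X i ^+ m i.

(** The span of the box monomials over the image of [h], the abstract counterpart of [chi]. *)
Definition spanned (p : A) : Prop :=
  exists q : box -> A, p = \sum_m h (q m) * boxmon m.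

Lemma spannedD p q : spanned p -> spanned q -> spanned (p + q).
Proof.
move=> [a ->] [b ->]; exists (fun m => a m + b m); rewrite -big_split.
by apply: eq_bigr => m _; rewrite rmorphD mulrDl.
Qed.

Lemma spannedM r p : spanned p -> spanned (h r * p).
Proof.
move=> [a ->]; exists (fun m => r * a m); rewrite mulr_sumr.
by apply: eq_bigr => m _; rewrite rmorphM mulrA.
Qed.

Lemma spannedZ c p : spanned p -> spanned (c *: p).
Proof. by move/(spannedM c%:A); rewrite hA mulr_algl. Qed.

Lemma spanned0 : spanned 0.
Proof. by exists (fun=> 0); rewrite big1 // => m _; rewrite rmorph0 mul0r. Qed.

Lemma spanned_sum (I : finType) (f : I -> A) :
  (forall i, spanned (f i)) -> spanned (\sum_i f i).
Proof.
by move=> sf; apply: big_ind => //; [exact: spanned0 | exact: spannedD].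
Qed.

Lemma spanned_boxmon m : spanned (boxmon m).
Proof.
exists (fun m' => (m' == m)%:R); rewrite (bigD1 m) //= big1 ?addr0 ?eqxx.
  by rewrite rmorph1 mul1r.
by move=> m' /negPf ->; rewrite rmorph0 mul0r.
Qed.

(** The product leaves the box only when the exponent of [X i] reaches [N]; then [X i ^+ N] is
    [h (X i)], a scalar, plus lower powers. *)
Lemma spanned_boxmonX m i : spanned (boxmon m * X i).
Proof.
pose rest := \prod_(j | j != i) X j ^+ m j.
have sX a : (a < N)%N -> spanned (X i ^+ a * rest).
  move=> aN; pose m' : box := [ffun j => if j == i then Ordinal aN else m j].
  rewrite (_ : _ * _ = boxmon m'); first exact: spanned_boxmon.
  rewrite /boxmon [RHS](bigD1 i) //= ffunE eqxx; congr (_ * _).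
  by apply: eq_bigr => j /negPf ji; rewrite ffunE ji.
have -> : boxmon m * X i = X i ^+ (m i).+1 * rest.
  by rewrite /boxmon (bigD1 i) //= mulrAC exprSr.
have := ltn_ord (m i); rewrite leq_eqVlt => /predU1P[->|]; last exact: sX.
have [c ->] := expr_tcheb (X i) N_gt0.
rewrite -hX mulrDl; apply: spannedD.
  (* The cofactor of the scalar [h (X i)] is [rest], the box monomial with exponent 0 at [i]. *)
  by apply: spannedM; rewrite -[rest]mul1r -(expr0 (X i)); apply: sX.
rewrite mulr_suml; apply: spanned_sum => j.
by rewrite -scalerAl; apply/spannedZ/sX.
Qed.

Lemma spannedMX p i : spanned p -> spanned (p * X i).
Proof.
move=> [q ->]; rewrite mulr_suml; apply: spanned_sum => m.
by rewrite -mulrA; apply/spannedM/spanned_boxmonX.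
Qed.

Lemma spanned_monomial (e : 'I_n -> nat) : spanned (\prod_i X i ^+ e i).
Proof.
elim/big_rec: _ => [|i q _ sq].
  rewrite (_ : 1 = boxmon [ffun=> Ordinal N_gt0]); first exact: spanned_boxmon.
  by rewrite /boxmon big1 // => i _; rewrite ffunE expr0.
rewrite mulrC; elim: (e i) => [|m IHm]; first by rewrite expr0 mulr1.
by rewrite exprSr mulrA; apply: spannedMX.
Qed.

End ThreadedSpan.

(** * The localized skein algebra of the pair of pants *)

Section PairOfPants.
Variables (R : realType) (N : nat).
Hypothesis N_gt0 : (0 < N)%N.

Local Notation skein := (skein R).
Local Notation thread := (@thread R N).
Local Notation chi_ring := (@chi_ring R N).
Local Notation loc_skein := (@loc_skein R N).
Local Notation box := {ffun 'I_3 -> 'I_N}.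

Let X (i : 'I_3) : skein := 'X_i.

Lemma skein_spanned p : spanned N (thread : {rmorphism skein -> skein}) X p.
Proof.
have threadA c : thread c%:A = c%:A.
  have cA : c%:A = c%:MP :> skein := alg_mpolyC _ c.
  by rewrite cA [LHS]comp_mpolyC.
have thread_X i : thread (X i) = tcheb N (X i).
  by rewrite [LHS]comp_mpolyXU -tnth_nth tnth_mktuple.
elim/mpolyind: p => [|c m p _ _ IH]; first exact: spanned0.
apply: spannedD => //; apply: spannedZ => //.
by rewrite mpolyXE_id; exact: spanned_monomial.
Qed.

Let chi_thread q : thread q \in chi N.
Proof. by apply/asboolP; exists q. Qed.

Let loc_of_skein_proof (p : skein) : p%:F \in @loc_pred R N.
Proof.
apply/asboolP; exists p, 1.
by split; rewrite ?rpred1 ?oner_eq0 // tofrac1 divr1.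
Qed.

(** Expand the numerator of [p / s] in box monomials over [chi]; as [s] lies in [chi], dividing by
    it keeps the coefficients in the fraction field of [chi]. *)
Lemma loc_skein_finite_dimensional :
  finite_dimensional (loc_skein : lmodType {fraction chi_ring}).
Proof.
pose v (m : box) : loc_skein :=
  Sub (boxmon X m)%:F (loc_of_skein_proof (boxmon X m)).
apply: (finite_dimensional_span (v := v)) => u.
have /asboolP[p [s [sc s0 us]]] := valP u.
have [q pE] := skein_spanned p.
pose s' : chi_ring := Sub s sc.
pose t' m : chi_ring := Sub (thread (q m)) (chi_thread (q m)).
exists (fun m => (t' m)%:F / s'%:F).
apply: val_inj; rewrite us pE raddf_sum rmorph_sum mulr_suml.
apply: eq_bigr => m _.
have s'0 : s' != 0 by rewrite -(inj_eq val_inj) rmorph0.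
(* Scalars act through [chi_frac_incl], so the identity is checked in the fraction field of the
   skein algebra. *)
transitivity (@chi_frac_incl R N ((t' m)%:F / s'%:F) * (boxmon X m)%:F) => //.
rewrite [chi_frac_incl _ _ _](frac_mapE (@val_chi_inj R N)) //.
by rewrite [RHS]mulrAC; congr (_ / _); exact: tofracM.
Qed.

(** Characteristic 0 is pulled back along the embedding into the fractions of a complex polynomial
    ring. *)
Lemma chi_frac_natr_neq0 n : (0 < n)%N -> n%:R != 0 :> {fraction chi_ring}.
Proof.
move=> n0; rewrite -(fmorph_eq0 (@chi_frac_incl R N)) rmorph_nat.
rewrite -(rmorph_nat (@FracField.tofrac skein)) tofrac_eq0.
by rewrite -mpolyC_nat mpolyC_eq0 pnatr_eq0 -lt0n.
Qed.

(** Cancellation holds in the ambient field of fractions. *)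
Lemma loc_skein_mulI (a : loc_skein) : a != 0 -> injective (fun v => a * v).
Proof.
move=> a0 u v /(congr1 \val); rewrite !rmorphM => /mulfI uv; apply/val_inj/uv.
by rewrite -(rmorph0 (\val : loc_skein -> _)) (inj_eq val_inj).
Qed.

End PairOfPants.

Theorem proposition4p2 (R : realType) (N : nat) (hN : (3 <= N)%N)
  (oddN : odd N) : frobenius (@Tr R N).
Proof.
have N_gt0 : (0 < N)%N by apply: leq_trans hN.
have fd := loc_skein_finite_dimensional R N_gt0.
split=> //.
  by move=> c a b; rewrite /Tr (trace_mul_scalar fd) mulrDr mulrCA.
move=> a a0; have [b ab] := right_inverse fd (loc_skein_mulI a0).
(* Here Tr 1 is [n] divided by N^3, with [n] the positive trace of the identity. *)
exists b; rewrite ab /Tr; have [n n0 ->] := trace_mul1 fd.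
by rewrite mulf_neq0 ?invr_eq0 ?chi_frac_natr_neq0 // expn_gt0 N_gt0.
Qed.
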